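(* Let $\kappa$ be an infinite cardinal and $B_0=\{(X,\,X\cap Z,\,Z): X,Z\in\mathcal{F}(\kappa),\ X\sim Z\}$. Every complemented bounded sublattice $L$ of $S$ with $B_0\subsetneq L$ contains an element $(A,B,C)$ with $B\not\subseteq A$.
   Context: $\mathcal{F}(\kappa)$ is the Boolean lattice of subsets $X\subseteq\kappa$ that are finite or cofinite. For $X,Z\in\mathcal{F}(\kappa)$, $X\sim Z$ means that either both $X,Z$ are finite or both $\kappa\setminus X,\kappa\setminus Z$ are finite. Let $\mu(A,B,C)=(A\cap B)\cup(A\cap C)\cup(B\cap C)$; a triple is balanced if $A\cap B=A\cap C=B\cap C$. $S$ is the set of balanced triples $(A,B,C)\in\mathcal{F}(\kappa)^3$ with $C\setminus\mu(A,B,C)$ finite, ordered componentwise; it is a bounded lattice with componentwise meet, join $(A,B,C)\vee(A',B',C')=(U_1\cup m,U_2\cup m,U_3\cup m)$ where $U_1=A\cup A'$, $U_2=B\cup B'$, $U_3=C\cup C'$, $m=\mu(U_1,U_2,U_3)$, and bounds $(\emptyset,\emptyset,\emptyset)$, $(\kappa,\kappa,\kappa)$. A complemented bounded sublattice is a sublattice containing both bounds in which every element has a complement. (In the paper the set $B_0$ is called $B$.) *)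

(* Defs.v *)
(* MathComp-Analysis classical world: subsets of an infinite type T model
   subsets of the infinite cardinal kappa = |T|. *)
From HB Require Import structures.
From mathcomp Require Import all_boot.
From mathcomp Require Import boolp classical_sets cardinality.
Set Implicit Arguments. Unset Strict Implicit. Unset Printing Implicit Defensive.
Local Open Scope classical_set_scope.

Section Defs.
Variable T : Type.

Definition finco (X : set T) : Prop := finite_set X \/ finite_set (~` X).

Definition simF (X Z : set T) : Prop :=
  (finite_set X /\ finite_set Z) \/ (finite_set (~` X) /\ finite_set (~` Z)).

Definition mu (A B C : set T) : set T := (A `&` B) `|` (A `&` C) `|` (B `&` C).

Record triple := Triple { t1 : set T; t2 : set T; t3 : set T }.

Definition balanced (t : triple) : Prop :=
  t1 t `&` t2 t = t1 t `&` t3 t /\ t1 t `&` t3 t = t2 t `&` t3 t.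

Definition Sset : set triple :=
  [set t | [/\ finco (t1 t), finco (t2 t), finco (t3 t), balanced t &
             finite_set (t3 t `\` mu (t1 t) (t2 t) (t3 t))]].

Definition tmeet (s t : triple) : triple :=
  Triple (t1 s `&` t1 t) (t2 s `&` t2 t) (t3 s `&` t3 t).

Definition tjoin (s t : triple) : triple :=
  let U1 := t1 s `|` t1 t in
  let U2 := t2 s `|` t2 t in
  let U3 := t3 s `|` t3 t in
  let m := mu U1 U2 U3 in
  Triple (U1 `|` m) (U2 `|` m) (U3 `|` m).

Definition tbot : triple := Triple set0 set0 set0.
Definition ttop : triple := Triple setT setT setT.

Definition complemented_bounded_sublattice (L : set triple) : Prop :=
  [/\ L `<=` Sset, L tbot /\ L ttop,
      (forall s t, L s -> L t -> L (tmeet s t)),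
      (forall s t, L s -> L t -> L (tjoin s t)) &
      (forall s, L s -> exists t, [/\ L t, tmeet s t = tbot & tjoin s t = ttop])].

Definition B0 : set triple :=
  [set t | exists X Z, [/\ finco X, finco Z, simF X Z & t = Triple X (X `&` Z) Z]].

End Defs.

(* Main.v *)
Require Import Defs.
From mathcomp Require Import all_boot.
From mathcomp Require Import boolp classical_sets cardinality.
Local Open Scope classical_set_scope.

(* Suppose every element (A, B, C) of L had B <= A.  Balance then forces
   B = A /\ C, and C \ A <= C \ mu(A, B, C) is finite, so an element of L
   outside B_0 has A cofinite and C finite.  Its complement (A', B', C') meets
   it in the bottom, so A' is finite, hence so is C'.  But the third component
   of a join only grows by middle components, which lie inside third ones, so
   the third component of their join is finite, whereas the join must be the
   top (T, T, T) with T infinite. *)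

Section BalancedTriples.
Context {T : Type}.
Implicit Types (s t : triple T).

Lemma Sset_t2E {t} : Sset t -> t2 t `<=` t1 t -> t2 t = t1 t `&` t3 t.
Proof.
move=> [_ _ _ [<- _] _] t21; apply/seteqP; split=> x; last by case.
by move=> t2x; split=> //; apply: t21.
Qed.

Lemma Sset_finite_t3Dt1 {t} :
  Sset t -> t2 t `<=` t1 t -> finite_set (t3 t `\` t1 t).
Proof.
move=> [_ _ _ _ fin_t3Dmu] t21; apply: sub_finite_set fin_t3Dmu.
move=> x [t3x t1Nx]; split=> // -[[[]|[]]|[/t21]] //.
Qed.

Lemma Sset_finite_t3 {t} :
  Sset t -> t2 t `<=` t1 t -> finite_set (t1 t) -> finite_set (t3 t).
Proof.
move=> St t21 fin_t1.
apply: (sub_finite_set (B := (t3 t `\` t1 t) `|` t1 t)).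
  by move=> x t3x; have [t1x|t1Nx] := pselect (t1 t x); [right|left].
by rewrite finite_setU; split=> //; exact: Sset_finite_t3Dt1.
Qed.

Lemma Sset_notB0 {t} : Sset t -> t2 t `<=` t1 t -> ~ B0 t ->
  finite_set (~` t1 t) /\ finite_set (t3 t).
Proof.
move=> St t21 tNB0; have [fco1 _ fco3 _ _] := St.
have B0t : simF (t1 t) (t3 t) -> B0 t.
  move=> sim13; exists (t1 t), (t3 t); split=> //.
  by rewrite -(Sset_t2E St t21); case: (t).
have cofin_t1 : finite_set (~` t1 t).
  case: fco1 => // fin_t1; exfalso; apply/tNB0/B0t.
  by left; split; last exact: Sset_finite_t3.
split=> //; case: fco3 => // cofin_t3.
by exfalso; apply/tNB0/B0t; right.
Qed.

Lemma t3_tjoin_sub {s t} :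
  t3 (tjoin s t) `<=` (t2 s `|` t3 s) `|` (t2 t `|` t3 t).
Proof.
move=> x [[h|h]|[[[_ [h|h]]|[_ [h|h]]]|[[h|h] _]]];
  by [left; left|left; right|right; left|right; right].
Qed.

Lemma tmeet_bot_t1 {s t} : tmeet s t = tbot T -> t1 t `<=` ~` t1 s.
Proof. by move=> st_bot x t1x t1sx; have : t1 (tmeet s t) x by []; rewrite st_bot. Qed.

End BalancedTriples.

Theorem corollary5p5 (T : Type) (Tinf : infinite_set (@setT T))
  (L : set (triple T)) :
  complemented_bounded_sublattice L ->
  @B0 T `<=` L -> @B0 T <> L ->
  exists2 t, L t & ~ (t2 t `<=` t1 t).
Proof.
move=> [LS [_ _] _ _ Lcompl] B0L B0NL.
apply: contrapT => noWitness.
have t21 t : L t -> t2 t `<=` t1 t.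
  by move=> Lt; apply: contrapT => t2Nt1; apply: noWitness; exists t.
have fin_t23 t : L t -> finite_set (t3 t) -> finite_set (t2 t `|` t3 t).
  move=> Lt fin_t3; rewrite finite_setU; split=> //.
  by apply: sub_finite_set fin_t3; rewrite (Sset_t2E (LS t Lt) (t21 t Lt)) => x [].
have [t Lt tNB0] : exists2 t, L t & ~ B0 t.
  apply: contrapT => allB0; apply: B0NL; apply/seteqP; split=> // t Lt.
  by apply: contrapT => tNB0; apply: allB0; exists t.
have [cofin_t1 fin_t3] := Sset_notB0 (LS t Lt) (t21 t Lt) tNB0.
have [t' [Lt' meet_bot join_top]] := Lcompl t Lt.
have fin_t3' : finite_set (t3 t').
  apply: Sset_finite_t3 (LS t' Lt') (t21 t' Lt') _.
  exact: sub_finite_set (tmeet_bot_t1 meet_bot) cofin_t1.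
apply: Tinf; apply: (sub_finite_set (B := (t2 t `|` t3 t) `|` (t2 t' `|` t3 t'))).
  by move=> x _; apply: t3_tjoin_sub; rewrite join_top.
by rewrite finite_setU; split; [exact: fin_t23 | exact: fin_t23].
Qed.
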